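(* For each even integer $n\geq 60$ there exists a cyclically $4$-edge-connected cubic graph of girth $5$ on $n$ vertices which does not admit a $P$-coloring.
   Context: $P$ denotes the Petersen graph. A $P$-coloring (Petersen coloring) of a cubic graph $G$ is a map $\varphi:E(G)\to E(P)$ mapping any two adjacent edges of $G$ to two adjacent (distinct, sharing a vertex) edges of $P$. A cubic graph is cyclically $k$-edge-connected if no set of fewer than $k$ edges disconnects it into two components, each containing a cycle. *)

(* Defs.v *)
From mathcomp Require Import all_boot.

Set Implicit Arguments.
Unset Strict Implicit.
Unset Printing Implicit Defensive.

Record sgraph : Type := SGraph {
  svertex :> finType;
  sedge : rel svertex;
  sedge_sym : symmetric sedge;
  sedge_irrefl : irreflexive sedge }.

Section Graphs.

Variable G : sgraph.

Definition edges : {set {set G}} :=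
  [set [set x; y] | x in G, y in G & sedge x y].

Definition adjacent_edges (e f : {set G}) : bool :=
  (e != f) && [exists v : G, (v \in e) && (v \in f)].

Definition cubic : Prop := forall x : G, #|[set y | sedge x y]| = 3.

(* The bound [2 < size c] excludes the empty sequence and the closed walk
   running back and forth along one edge. *)
Definition graph_cycle (c : seq G) : bool :=
  [&& 2 < size c, uniq c & cycle (@sedge G) c].

Definition has_girth (g : nat) : Prop :=
  (exists2 c : seq G, graph_cycle c & size c = g) /\
  (forall c : seq G, graph_cycle c -> g <= size c).

Definition components : {set {set G}} :=
  [set [set y | connect (@sedge G) x y] | x : G].

Definition contains_cycle (C : {set G}) : Prop :=
  exists2 c : seq G, graph_cycle c & {subset c <= C}.

Section DeleteEdges.

Variable S : {set {set G}}.

Definition del_rel : rel G :=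
  fun x y => sedge x y && ([set x; y] \notin S).

Lemma del_rel_sym : symmetric del_rel.
Proof. by move=> x y; rewrite /del_rel /= sedge_sym setUC. Qed.

Lemma del_rel_irrefl : irreflexive del_rel.
Proof. by move=> x; rewrite /del_rel /= sedge_irrefl. Qed.

Definition del_edges : sgraph := SGraph del_rel_sym del_rel_irrefl.

End DeleteEdges.

End Graphs.

(* The case [S = set0] makes a cubic graph with this property connected for
   [0 < k], since every component of a cubic graph contains a cycle. *)
Definition cyclically_edge_connected (G : sgraph) (k : nat) : Prop :=
  forall S : {set {set G}}, S \subset edges G -> #|S| < k ->
  ~ exists C1 C2 : {set del_edges S},
      [/\ C1 \in components (del_edges S), C2 \in components (del_edges S),
          C1 != C2, contains_cycle C1 & contains_cycle C2].

(* The Petersen graph as the Kneser graph KG(5, 2). *)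
Definition petersen_vertex : finType := {A : {set 'I_5} | #|A| == 2}.

Definition petersen_rel : rel petersen_vertex :=
  fun A B => [disjoint val A & val B].

Lemma petersen_sym : symmetric petersen_rel.
Proof. by move=> A B; rewrite /petersen_rel /= disjoint_sym. Qed.

Lemma petersen_irrefl : irreflexive petersen_rel.
Proof.
by move=> A; rewrite /petersen_rel /= -setI_eq0 setIid -cards_eq0 (eqP (valP A)).
Qed.

Definition petersen : sgraph := SGraph petersen_sym petersen_irrefl.

(* Only the values of [phi] on [edges G] matter. *)
Definition P_coloring (G : sgraph) (phi : {set G} -> {set petersen}) : Prop :=
  (forall e, e \in edges G -> phi e \in edges petersen) /\
  (forall e f, e \in edges G -> f \in edges G ->
     adjacent_edges e f -> adjacent_edges (phi e) (phi f)).

(* Main.v *)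
Require Import Defs.
From mathcomp Require Import all_boot zify.

Set Implicit Arguments.
Unset Strict Implicit.
Unset Printing Implicit Defensive.

(** A Petersen colouring of a cubic graph maps the three edges at each vertex to the three edges
    at a vertex of P. Call p8 the graph P minus two adjacent vertices, with its four dangling
    edges paired into two strands. In a colouring either both strands of p8 have the same colour
    at their two ends, or the four dangling edges surround an edge of P.

    A search yields cubic graphs on 60, 62, 64 and 66 vertices with two disjoint edges e and f
    such that, when e and f are cut in the middle, every colouring gives adjacent colours to the
    first halves of e and f, and the second halves of e and f never both repeat these colours.
    Hence these graphs have no colouring. When a p8 is inserted into e and f, its two strands
    start with adjacent colours; around an edge these starts would lie at opposite ends, so the
    strands keep their colours, and the property is inherited with 8 more vertices.

    Cyclic connectivity is the statement that every edge cut with at least two vertices on both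
    sides has at least four edges. This is preserved when two disjoint edges are replaced by p8,
    or by two subdivision vertices joined by a new edge; the four small graphs arise from K4 by
    the latter operation. *)

(** * Edges of the Petersen graph *)

Definition edge := (nat * nat)%type.

Definition share (p q : edge) : bool :=
  [|| p.1 == q.1, p.1 == q.2, p.2 == q.1 | p.2 == q.2].

Definition duads : seq edge :=
  Eval vm_compute in [seq (i, j) | i <- iota 0 5, j <- iota i.+1 (4 - i)].

Definition pedges : seq (edge * edge) :=
  Eval vm_compute in [seq (p, q) | p <- duads, q <- [seq q <- drop (index p duads) duads | ~~
    share p q]].

Definition pshare (e f : edge * edge) : bool :=
  [|| e.1 == f.1, e.1 == f.2, e.2 == f.1 | e.2 == f.2].

(** A colour is a position in [pedges], hence a number below 15. Adjacency of colours is tabulated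
    because the searches query it all the time. *)
Definition padj_spec (x y : nat) : bool :=
  let d := ((0, 0), (0, 0)) in
  (x != y) && pshare (nth d pedges x) (nth d pedges y).

Definition padj_table : seq (seq nat) :=
  Eval vm_compute in
  [seq [seq y <- iota 0 15 | padj_spec x y] | x <- iota 0 15].

Definition pnbrs (x : nat) : seq nat := nth [::] padj_table x.
Definition padj (x y : nat) : bool := y \in pnbrs x.

Lemma padj_tableE : padj_table = [seq [seq y <- iota 0 15 | padj_spec x y] | x <- iota 0 15].
Proof. by vm_compute. Qed.

Lemma padjE x y : padj x y = [&& x < 15, y < 15 & padj_spec x y].
Proof.
rewrite /padj /pnbrs padj_tableE; case: ltnP => hx; last first.
  by rewrite nth_default // size_map size_iota.
by rewrite (nth_map 0) ?size_iota // nth_iota // mem_filter mem_iota andbC.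
Qed.

Lemma padj_sym x y : padj x y = padj y x.
Proof.
rewrite !padjE /padj_spec /pshare [x == y]eq_sym andbCA; congr [&& _, _, _ & _].
set e := nth _ _ _; set f := nth _ _ _.
rewrite !(eq_sym f.1) !(eq_sym f.2).
by case: (e.1 == f.1); case: (e.1 == f.2); case: (e.2 == f.1); case: (e.2 == f.2).
Qed.

Lemma padj_lt x y : padj x y -> x < 15.
Proof. by rewrite padjE => /and3P[]. Qed.

Definition duad_set (p : edge) : {set 'I_5} := [set i : 'I_5 | (i == p.1 :> nat) || (i == p.2 :>
  nat)].

Lemma card_duad_set p : p \in duads -> #|duad_set p| == 2.
Proof.
have /allP h : all (fun p : edge => p.1 < p.2 < 5) duads by vm_compute.
move=> /h /andP[lt12 lt2]; have lt1 := ltn_trans lt12 lt2.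
rewrite (_ : duad_set p = [set Ordinal lt1; Ordinal lt2]) ?cards2; last first.
  by apply/setP=> i; rewrite !inE -!val_eqE.
by rewrite -val_eqE /= (ltn_eqF lt12).
Qed.

Definition pvertex0 : petersen_vertex := Sub (duad_set (0, 1)) (card_duad_set (isT : (0, 1) \in
  duads)).

Definition pvertex (p : edge) : petersen_vertex := insubd pvertex0 (duad_set p).

Lemma val_pvertex p : p \in duads -> val (pvertex p) = duad_set p.
Proof. by move=> hp; rewrite val_insubd card_duad_set. Qed.

Lemma pvertex_inj : {in duads &, injective pvertex}.
Proof.
move=> p q hp hq /(congr1 val); rewrite !val_pvertex // => /setP eq_pq.
have /allP/(_ p hp)/allP/(_ q hq)/implyP h : all (fun p : edge => all (fun q : edge =>
   all (fun k => ((k == p.1) || (k == p.2)) == ((k == q.1) || (k == q.2))) (iota 0 5)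
   ==> (p == q)) duads) duads by vm_compute.
apply/eqP/h/allP=> k; rewrite mem_iota => /= lt_k.
by have := eq_pq (Ordinal lt_k); rewrite !inE /= => ->.
Qed.

Lemma pvertex_surj (A : petersen_vertex) : exists2 p, p \in duads & A = pvertex p.
Proof.
have /cards2P[x [y [ne_xy defA]]] := valP A.
wlog lt_xy : x y ne_xy defA / x < y.
  move=> IH; case: (ltngtP x y) => [|lt_yx|/val_inj eq_xy]; first exact: IH.
  - by apply: (IH y x) => //; [rewrite eq_sym | rewrite setUC].
  - by rewrite eq_xy eqxx in ne_xy.
have hp : (x : nat, y : nat) \in duads.
  have /allP/(_ x)/[!mem_iota]/(_ (ltn_ord x))/allP/(_ y)/[!mem_iota]/(_ (ltn_ord y))/implyP h :
    all (fun i => all (fun j => (i < j) ==> ((i, j) \in duads)) (iota 0 5)) (iota 0 5).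
    by vm_compute.
  exact: h.
exists (x : nat, y : nat) => //; apply: val_inj; rewrite val_pvertex // defA.
by apply/setP=> i; rewrite !inE.
Qed.

Definition pedge_set (e : edge * edge) : {set petersen} := [set pvertex e.1; pvertex e.2].

Definition pcode (e : {set petersen}) : nat := find (fun q => e == pedge_set q) pedges.

Definition pedge0 : edge * edge := ((0, 0), (0, 0)).

Lemma pcodeK e : e \in edges petersen ->
  pcode e < size pedges /\ e = pedge_set (nth pedge0 pedges (pcode e)).
Proof.
case/imset2P=> A B _; rewrite inE => adjAB defe.
have [p hp defA] := pvertex_surj A; have [q hq defB] := pvertex_surj B.
suff has_e : has (fun q => e == pedge_set q) pedges.
  by split; [rewrite /pcode -has_find
            | apply/eqP; have := nth_find pedge0 has_e].
have dis : ~~ share p q.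
  apply/negP=> sh; move: adjAB; rewrite andTb /= /petersen_rel defA defB !val_pvertex //.
  rewrite -setI_eq0 => /eqP/setP dis.
  have /allP/(_ p hp)/allP/(_ q hq)/implyP/(_ sh)/hasP[k] : all (fun p : edge => all (fun q : edge
    =>
    share p q ==> has (fun k => ((k == p.1) || (k == p.2)) && ((k == q.1) || (k == q.2)))
    (iota 0 5)) duads) duads by vm_compute.
  rewrite mem_iota => /= lt_k; have := dis (Ordinal lt_k); rewrite !inE /= => -> //.
have /allP/(_ p hp)/allP/(_ q hq)/implyP/(_ dis) : all (fun p : edge => all (fun q : edge =>
  ~~ share p q ==> ((p, q) \in pedges) || ((q, p) \in pedges)) duads) duads by vm_compute.
case/orP=> hpq; apply/hasP; [exists (p, q) | exists (q, p)] => //.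
  by rewrite defe defA defB.
by rewrite defe defA defB /pedge_set setUC.
Qed.

Lemma padj_pedge_set i j : i < size pedges -> j < size pedges ->
  adjacent_edges (pedge_set (nth pedge0 pedges i)) (pedge_set (nth pedge0 pedges j)) ->
  padj i j.
Proof.
move=> lti ltj /andP[ne_ij /existsP[v]]; rewrite padjE (_ : i < 15) // (_ : j < 15) // !andTb.
rewrite /padj_spec (contraNneq _ ne_ij) => [|->//]; rewrite andTb.
move: (nth _ _ i) (mem_nth pedge0 lti) (nth _ _ j) (mem_nth pedge0 ltj) => p hp q hq.
have /allP hd : all (fun e : edge * edge => (e.1 \in duads) && (e.2 \in duads)) pedges.
  by vm_compute.
have /andP[p1 p2] := hd p hp; have /andP[q1 q2] := hd q hq.
by rewrite !inE /pshare => /andP[/orP[]/eqP->] /orP[]/eqP/pvertex_inj->//; rewrite eqxx ?orbT.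
Qed.

Lemma padj_pcode e f : e \in edges petersen -> f \in edges petersen ->
  adjacent_edges e f -> padj (pcode e) (pcode f).
Proof.
move=> /pcodeK + /pcodeK; move: (pcode e) (pcode f) => i j [lti ->] [ltj ->].
exact: padj_pedge_set.
Qed.

(** * Proper colourings and exhaustive search *)

Definition point0 : edge := (0, 0).

(** Colours belong to positions in the list, not to pairs of ends, so that several dangling edges at
    one vertex stay distinct. *)
Definition proper (L : seq edge) (c : nat -> nat) : Prop :=
  forall i j, i < size L -> j < size L -> i != j ->
  share (nth point0 L i) (nth point0 L j) -> padj (c i) (c j).

Lemma share_sym p q : share p q = share q p.
Proof.
rewrite /share !(eq_sym q.1) !(eq_sym q.2).
by case: (p.1 == q.1); case: (p.1 == q.2); case: (p.2 == q.1); case: (p.2 == q.2).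
Qed.

(** A map of edges that has to be injective on adjacent pairs only: [tight_uncolourable] sends both
    halves of an edge to that edge. *)
Definition embeds (T L : seq edge) (m : nat -> nat) : Prop :=
  forall i j, i < size T -> j < size T -> i != j ->
  share (nth point0 T i) (nth point0 T j) ->
  [/\ m i < size L, m j < size L, m i != m j
    & share (nth point0 L (m i)) (nth point0 L (m j))].

Lemma proper_embeds T L m c : embeds T L m -> proper L c -> proper T (c \o m).
Proof. by move=> emb pc i j hi hj ne sh; have [? ? ? ?] := emb i j hi hj ne sh; apply: pc. Qed.

Definition embedsb (T L : seq edge) (s : seq nat) : bool :=
  all (fun i => all (fun j => (i != j) && share (nth point0 T i) (nth point0 T j) ==>
    let k := nth 0 s i in let l := nth 0 s j in
    [&& k < size L, l < size L, k != l & share (nth point0 L k) (nth point0 L l)])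
    (iota 0 (size T))) (iota 0 (size T)).

Lemma embedsP T L s : embedsb T L s -> embeds T L (nth 0 s).
Proof.
move=> /allP h i j hi hj ne sh; have := h i; rewrite mem_iota => /(_ hi)/allP/(_ j).
by rewrite mem_iota => /(_ hj); rewrite ne sh => /and4P[].
Qed.

(* [p8] is the Petersen graph minus two adjacent vertices. A dangling edge at the vertex [t]
   is written [(t, t)]. *)
Definition claw : seq edge := nseq 3 (0, 0).
Definition p8_inner : seq edge :=
  [:: (0, 4); (0, 5); (0, 7); (1, 3); (1, 5); (1, 6); (2, 3); (2, 4); (3, 7); (4, 6)].
Definition p8 : seq edge := [:: (6, 6); (7, 7); (2, 2); (5, 5)] ++ p8_inner.

(** Distance at most 2 in the line graph of P. That graph has diameter 3, with two colours at
    distance 3 from each colour. *)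
Definition pdist2 (x y : nat) : bool :=
  [|| x == y, padj x y | has (padj^~ y) (pnbrs x)].

(* The colours of the last three dangling edges of [p8] when the first has colour [x]:
   either both strands keep their colours, or the four edges surround an edge [m]. *)
Definition p8_rows_spec (x : nat) : seq (seq nat) :=
  [seq [:: t.1; t.2.1; t.2.2] | t <- [seq (y, t) | y <- iota 0 15,
         t <- [seq (z, w) | z <- iota 0 15, w <- iota 0 15]] &
   let y := t.1 in let z := t.2.1 in let w := t.2.2 in
   [&& y == x, z == w & pdist2 x z] ||
   [&& padj x y, padj z w & has (fun m =>
      [&& y \in pnbrs m, z \in pnbrs m, w \in pnbrs m, z != x & ~~ padj x z]) (pnbrs x)]].

Definition p8_table : seq (seq (seq nat)) :=
  Eval vm_compute in [seq p8_rows_spec x | x <- iota 0 15].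

Definition claw_table : seq (seq (seq nat)) :=
  Eval vm_compute in
  [seq [seq [:: t.1; t.2] | t <- [seq (y, z) | y <- pnbrs x, z <- pnbrs x] & padj t.1 t.2]
  | x <- iota 0 15].

(** From one known colour, a step at a vertex yields two more and a step at a copy of [p8] three, so
    the length [k] selects the table. *)
Definition rows (k x : nat) : seq (seq nat) :=
  nth [::] (if k == 2 then claw_table else p8_table) x.

Definition step := (nat * seq nat)%type.

Definition sat (g : nat -> nat) (s : step) : bool :=
  map g s.2 \in rows (size s.2) (g s.1).

(** Variables are numbered in the order of their colouring, so a partial colouring is a list. The
    value of a variable beyond the next one is dropped, which can only weaken the pruning. *)
Fixpoint extend (a : seq nat) (vs row : seq nat) : option (seq nat) :=
  match vs, row with
  | v :: vs', x :: row' =>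
      if v < size a then if nth 0 a v == x then extend a vs' row' else None
      else if v == size a then extend (rcons a x) vs' row'
      else extend a vs' row'
  | _, _ => Some a
  end.

Fixpoint search (leaf : pred (seq nat)) (st : seq step) (a : seq nat) : bool :=
  match st with
  | [::] => leaf a
  | s :: st' =>
      (s.1 < size a) &&
      all (fun row => if extend a s.2 row is Some a' then search leaf st' a' else true)
        (rows (size s.2) (nth 0 a s.1))
  end.

Lemma extend_mkseq g vs m : exists m', extend (mkseq g m) vs (map g vs) = Some (mkseq g m').
Proof.
elim: vs m => [|v vs IH] m /=; first by exists m.
rewrite size_mkseq; case: ltnP => [lt_vm|_]; first by rewrite nth_mkseq // eqxx.
case: eqP => [->|_]; last exact: IH.
have -> : rcons (mkseq g m) (g m) = mkseq g m.+1 by rewrite /mkseq -addn1 iotaD map_cat cats1.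
exact: IH.
Qed.

(** The branch of the search that follows [g] is never pruned, and all its partial colourings are
    prefixes of [g]. *)
Lemma searchP g leaf st m : all (sat g) st -> search leaf st (mkseq g m) ->
  exists m', leaf (mkseq g m').
Proof.
elim: st m => [|s st IH] m /=; first by exists m.
move=> /andP[sat_s sat_st] /andP[lt_s /allP h].
have := h (map g s.2); rewrite size_mkseq in lt_s; rewrite nth_mkseq // => /(_ sat_s).
by have [m' ->] := extend_mkseq g s.2 m; apply: IH.
Qed.

Lemma claw_sat L c i j k :
  proper L c -> embedsb claw L [:: i; j; k] -> sat c (i, [:: j; k]).
Proof.
move=> + /embedsP emb; move=> /(proper_embeds emb) pc.
have aij : padj (c i) (c j) by apply: (pc 0 1).
have aik : padj (c i) (c k) by apply: (pc 0 2).
have ajk : padj (c j) (c k) by apply: (pc 1 2).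
have /allP/(_ (c i))/[!mem_iota]/(_ (padj_lt aij))/allP/(_ (c j) aij)/allP/(_ (c k) aik)/implyP/(_
  ajk) :
  all (fun x => all (fun y => all (fun z =>
    padj y z ==> ([:: y; z] \in rows 2 x)) (pnbrs x)) (pnbrs x)) (iota 0 15) by vm_compute.
by [].
Qed.

(* [p8_vars] lists the edges of [p8] in the order in which the search colours them. *)
Definition p8_vars : seq nat := [:: 0; 9; 13; 7; 8; 4; 11; 3; 5; 6; 10; 12; 1; 2].
Definition p8_steps : seq step :=
  [:: (0, [:: 1; 2]); (1, [:: 3; 4]); (2, [:: 5; 6]); (4, [:: 7; 8]);
      (5, [:: 8; 9]); (3, [:: 10; 11]); (9, [:: 11; 12]); (10, [:: 6; 13])].

Lemma p8_rows c : proper p8 c -> [:: c 1; c 2; c 3] \in rows 3 (c 0).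
Proof.
move=> pc; pose g := c \o nth 0 p8_vars.
(* The dangling edges 1, 2 and 3 stand at places 12, 13 and 7 of [p8_vars]. *)
pose leaf a := (size a == 14) && ([:: nth 0 a 12; nth 0 a 13; nth 0 a 7] \in rows 3 (nth 0 a 0)).
have sat_g : all (sat g) p8_steps.
  by rewrite /=; do !(apply/andP; split=> //); apply: (claw_sat pc); vm_compute.
have lt_c0 : c 0 < 15 by apply: (@padj_lt _ (c 9)); apply: pc.
have /allP/(_ (c 0))/[!mem_iota]/(_ lt_c0) : all (fun x => search leaf p8_steps [:: x]) (iota 0 15).
  by vm_compute.
rewrite -[[:: c 0]]/(mkseq g 1) => /(searchP sat_g)[m /andP[]].
by rewrite size_mkseq => /eqP->.
Qed.

Definition cstep := (nat * seq nat * seq nat)%type.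

(** A whole copy of [p8] is a single step of the search: its inner edges only certify the embedding
    and are not coloured. *)
Definition cert_ok (L : seq edge) (vars : seq nat) (s : cstep) : bool :=
  let vs := s.1.1 :: s.1.2 in
  (size vs \in [:: 3; 4]) &&
  embedsb (if size vs == 3 then claw else p8) L ([seq nth 0 vars v | v <- vs] ++ s.2).

Lemma cert_sat L c vars s : proper L c -> cert_ok L vars s -> sat (c \o nth 0 vars) s.1.
Proof.
case: s => [[i [|j [|k [|l [|? ?]]]]] cert] pc //= /andP[_] emb.
  suff emb' : embedsb claw L [:: nth 0 vars i; nth 0 vars j; nth 0 vars k].
    exact: (claw_sat pc emb').
  exact: emb.
by have := p8_rows (proper_embeds (embedsP emb) pc).
Qed.

(** * Cutting two edges in the middle *)

Definition perm_duad (s : seq nat) (p : edge) : edge :=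
  let i := nth 0 s p.1 in let j := nth 0 s p.2 in if i < j then (i, j) else (j, i).

Definition perm_pedge (s : seq nat) (e : edge * edge) : nat :=
  let p := perm_duad s e.1 in let q := perm_duad s e.2 in
  find (fun f => (f == (p, q)) || (f == (q, p))) pedges.

(** The symmetric group on five points acting on P, each element stored as the list of images of the
    15 colours. *)
Definition pauts : seq (seq nat) :=
  Eval vm_compute in [seq map (perm_pedge s) pedges | s <- permutations (iota 0 5)].

Lemma padj_paut s x y : s \in pauts -> x < 15 -> y < 15 ->
  padj (nth 0 s x) (nth 0 s y) = padj x y.
Proof.
move=> hs ltx lty.
have /allP/(_ s hs)/allP/(_ x)/[!mem_iota]/(_ ltx)/allP/(_ y)/[!mem_iota]/(_ lty)/eqP-> // :
  all (fun s => all (fun x => all (fun y => padj (nth 0 s x) (nth 0 s y) == padj x y)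
    (iota 0 15)) (iota 0 15)) pauts by vm_compute.
Qed.

(** Automorphisms are transitive on ordered pairs of adjacent edges of P. A search may therefore
    start from the colours 0 and 1. *)
Lemma paut_flag x y : padj x y ->
  exists2 s, s \in pauts & nth 0 s x = 0 /\ nth 0 s y = 1.
Proof.
move=> adj_xy.
have /allP/(_ x)/[!mem_iota]/(_ (padj_lt adj_xy))/allP/(_ y adj_xy)/hasP[s hs /andP[/eqP sx /eqP
  sy]] :
  all (fun x => all (fun y => has (fun s => (nth 0 s x == 0) && (nth 0 s y == 1)) pauts)
    (pnbrs x)) (iota 0 15) by vm_compute.
by exists s.
Qed.

Definition halves (E : seq edge) : seq edge :=
  let e := nth point0 E 0 in let f := nth point0 E 1 in
  [:: (e.1, e.1); (e.2, e.2); (f.1, f.1); (f.2, f.2)] ++ drop 2 E.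

(* Colours 0 and 2 belong to the first halves of the first two edges of [E], colours 1 and 3
   to their second halves. *)
Definition tight (E : seq edge) : Prop :=
  forall c, proper (halves E) c ->
  padj (c 0) (c 2) /\ ~~ ((c 1 == c 0) && (c 3 == c 2)).

(** The bounds guarantee that all four ends have been coloured, so no default value of [nth] is
    read. *)
Definition tight_leaf (ends a : seq nat) : bool :=
  let x k := nth 0 a (nth 0 ends k) in
  [&& all (fun i => i < size a) ends, padj (x 0) (x 2) & ~~ ((x 1 == x 0) && (x 3 == x 2))].

(** [proper] does not restrict the colour of an edge without neighbours; for a touched edge it
    forces a genuine colour, below 15. *)
Definition touched (L : seq edge) (i : nat) : bool :=
  (i < size L) && has (fun j => (i != j) && share (nth point0 L i) (nth point0 L j)) (iota 0 (size
    L)).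

Definition tight_cert (E : seq edge) (vars : seq nat) (steps : seq cstep) (ends : seq nat) : bool :=
  [&& embedsb [:: point0; point0] (halves E) vars && all (touched (halves E)) [:: 0; 2],
      all (cert_ok (halves E) vars) steps,
      [seq nth 0 vars i | i <- ends] == [:: 0; 1; 2; 3]
    & search (tight_leaf ends) [seq s.1 | s <- steps] [:: 0; 1]].

Lemma proper_lt L c i : proper L c -> touched L i -> c i < 15.
Proof.
move=> pc /andP[hi /hasP[j]]; rewrite mem_iota => /= hj /andP[ne sh].
exact: padj_lt (pc i j hi hj ne sh).
Qed.

Lemma proper_paut L c s : s \in pauts -> proper L c -> proper L (nth 0 s \o c).
Proof.
move=> hs pc i j hi hj ne sh; have adj := pc i j hi hj ne sh.
by rewrite /= padj_paut ?(padj_lt adj) // (@padj_lt _ (c i)) // padj_sym.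
Qed.

Lemma tight_certP E vars steps ends : tight_cert E vars steps ends -> tight E.
Proof.
case/and4P=> /andP[emb /and3P[t0 t2 _]] certs /eqP def_ends srch c pc.
have adj01 : padj (c (nth 0 vars 0)) (c (nth 0 vars 1)).
  exact: (proper_embeds (embedsP emb) pc).
have [s hs [s0 s1]] := paut_flag adj01.
pose g := (nth 0 s \o c) \o nth 0 vars.
have sat_g : all (sat g) [seq s.1 | s <- steps].
  rewrite all_map; apply: sub_all certs => st; exact/cert_sat/proper_paut.
have def_a : [:: 0; 1] = mkseq g 2 by rewrite /mkseq /= /g /= s0 s1.
move: srch; rewrite def_a => /(searchP sat_g)[m].
have sz : size ends = 4 by have := congr1 size def_ends; rewrite size_map.
have endE k : k < 4 -> g (nth 0 ends k) = nth 0 s (c k).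
  move=> lt_k4; rewrite /g /=; congr (nth 0 s (c _)).
  rewrite -[RHS](nth_iota 0 0 lt_k4) (_ : iota 0 4 = [:: 0; 1; 2; 3]) // -def_ends.
  by rewrite (nth_map 0) ?sz.
rewrite /tight_leaf size_mkseq => /and3P[/allP le_m].
have nthE k : k < 4 -> nth 0 (mkseq g m) (nth 0 ends k) = nth 0 s (c k).
  by move=> lt_k4; rewrite nth_mkseq ?endE // le_m // mem_nth ?sz.
rewrite !nthE // padj_paut ?(proper_lt pc) // => -> ne; split=> //.
(* Only this direction is at stake: equal colours stay equal under the automorphism [s]. *)
by apply: contraNN ne => /andP[/eqP-> /eqP->]; rewrite !eqxx.
Qed.

Lemma share_half a b r : share (a, a) r -> share (a, b) r /\ share (b, a) r.
Proof. by rewrite /share /= => /or4P[] ->; rewrite ?orbT. Qed.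

(* A proper colouring of [E] colours both halves of the first two edges alike. *)
Lemma tight_uncolourable e f E c :
  uniq [:: e.1; e.2; f.1; f.2] -> tight (e :: f :: E) -> ~ proper (e :: f :: E) c.
Proof.
case: e f => [a b] [u v] uniq_ef tE pc.
have /and4P[] := uniq_ef; rewrite /= !inE !negb_or.
move=> /and3P[ab au av] /andP[bu bv] uv _.
set E1 := [:: (a, b), (u, v) & E].
have halvesE : halves E1 = [:: (a, a), (b, b), (u, u), (v, v) & E] by rewrite /halves /= drop0.
pose m i := if i < 2 then 0 else if i < 4 then 1 else i - 2.
suff emb : embeds (halves E1) E1 m.
  by have [_] := tE _ (proper_embeds emb pc); rewrite /m /= !eqxx.
(* The four ends are distinct, so no two of the four halves are adjacent; in particular not the two
   halves that [m] identifies. *)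
have half_half x y : x != y -> share (x, x) (y, y) = false.
  by move=> ne; rewrite /share /= (negPf ne).
have sub2 i : i.+4 - 2 = i.+2 by rewrite subSS subSS subn0.
have emb_lt i j : i < j -> j < size (halves E1) ->
    share (nth point0 (halves E1) i) (nth point0 (halves E1) j) ->
    m i < m j < size E1 /\ share (nth point0 E1 (m i)) (nth point0 E1 (m j)).
  rewrite halvesE /m.
  case: i j => [|[|[|[|i]]]] [|[|[|[|j]]]] //= lt_ij ltj sh; rewrite ?sub2 /=;
    first [by rewrite half_half in sh | by split=> //; apply/andP | split=> //].
  - by have [] := share_half b sh.
  - by have [] := share_half a sh.
  - by have [] := share_half v sh.
  - by have [] := share_half u sh.
move=> i j hi hj; rewrite neq_ltn => /orP[lt_ij|lt_ji] sh.
  have [/andP[lt_m lt_mj] ?] := emb_lt i j lt_ij hj sh.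
  by split=> //; [apply: ltn_trans lt_mj | rewrite neq_ltn lt_m].
have [|/andP[lt_m lt_mi] sh'] := emb_lt j i lt_ji hi; first by rewrite share_sym.
by split=> //; [apply: ltn_trans lt_mi | rewrite neq_ltn lt_m orbT | rewrite share_sym].
Qed.

(** * Replacing two edges by a gadget *)

Definition deg (E : seq edge) (v : nat) : nat :=
  count (fun p => p.1 == v) E + count (fun p => p.2 == v) E.

Definition cut (E : seq edge) (X : pred nat) : nat := count (fun p => X p.1 != X p.2) E.

Definition bounded (n : nat) (E : seq edge) : bool := all (fun p => (p.1 < n) && (p.2 < n)) E.

Definition loopless (E : seq edge) : bool := all (fun p => p.1 != p.2) E.

Definition well_connected (n : nat) (E : seq edge) : Prop :=
  forall X : pred nat, 1 < count X (iota 0 n) -> count X (iota 0 n) + 2 <= n -> 4 <= cut E X.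

Definition good (n : nat) (E : seq edge) : Prop :=
  [/\ bounded n E, loopless E, forall v, v < n -> deg E v = 3 & well_connected n E].

Definition shift (n : nat) (T : seq edge) : seq edge := [seq (n + p.1, n + p.2) | p <- T].

(* Replaces the first two edges [(a, b)] and [(c, d)] by a copy of the gadget [T] on the
   vertices [n, ..., n + m - 1], with [a], [b], [c], [d] joined to the terminals [t]. *)
Definition plug (n : nat) (t : nat * nat * nat * nat) (T E : seq edge) : seq edge :=
  let: (t0, t1, t2, t3) := t in
  if E is (a, b) :: (c, d) :: E' then
    [:: (n + t1, b); (n + t3, d); (a, n + t0); (c, n + t2)] ++ shift n T ++ E'
  else E.

Fixpoint all_bits (m : nat) (P : pred (seq bool)) : bool :=
  if m is m'.+1 then all_bits m' (fun z => P (true :: z)) && all_bits m' (fun z => P (false :: z))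
  else P [::].

Lemma all_bitsP m P : all_bits m P -> forall z, size z = m -> P z.
Proof.
elim: m P => [|m IH] P /=; first by move=> P0 [|].
by case/andP=> /IH Pt /IH Pf [|[] z] //= [sz]; [apply: Pt | apply: Pf].
Qed.

(** The entries of [y] tell which of the four ends of the removed edges lie in X. Here the removed
    edges in the cut are counted, in [local_cut] the edges that replace them. *)
Definition strands_cut (y : seq bool) : nat :=
  let y := nth false y in (y 0 != y 1) + (y 2 != y 3).

Definition local_cut (t : nat * nat * nat * nat) (T : seq edge) (y z : seq bool) : nat :=
  let: (t0, t1, t2, t3) := t in
  let y := nth false y in let z := nth false z in
  (z t1 != y 1) + ((z t3 != y 3) + ((y 0 != z t0) + ((y 2 != z t2) + cut T z))).

(** The three conditions on cuts serve, in this order, the sets X with at least two, with no and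
    with exactly one vertex outside the gadget; see [plug_cut_ge4]. *)
Definition gadget (m : nat) (t : nat * nat * nat * nat) (T : seq edge) : bool :=
  let: (t0, t1, t2, t3) := t in
  [&& all (fun i => i < m) [:: t0; t1; t2; t3], bounded m T, loopless T,
      all (fun v => deg T v + count_mem v [:: t0; t1; t2; t3] == 3) (iota 0 m)
    & all_bits 4 (fun y => all_bits m (fun z =>
        [&& strands_cut y <= local_cut t T y z,
            (count id y == 0) && (1 < count id z) ==> (4 <= local_cut t T y z)
          & (count id y <= 1) && (0 < count id z) ==> (strands_cut y < local_cut t T y z)]))].

Lemma cut_cons p E X : cut (p :: E) X = (X p.1 != X p.2) + cut E X.
Proof. by []. Qed.

Lemma cut_cat E F X : cut (E ++ F) X = cut E X + cut F X.
Proof. exact: count_cat. Qed.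

Lemma cut_shift n T X : cut (shift n T) X = cut T (fun i => X (n + i)).
Proof. by rewrite /cut count_map. Qed.

Lemma eq_cut n E X Y : bounded n E -> (forall i, i < n -> X i = Y i) -> cut E X = cut E Y.
Proof.
by move=> /allP bE eqXY; apply: eq_in_count => p /bE/andP[p1 p2]; rewrite !eqXY.
Qed.

Lemma cutC E X : cut E (predC X) = cut E X.
Proof. by apply: eq_count => p /=; case: (X _); case: (X _). Qed.

Lemma cut1 E v : loopless E -> cut E (pred1 v) = deg E v.
Proof.
rewrite /deg; elim: E => // -[a b] E IH /andP[ab /IH eqE].
rewrite cut_cons eqE /=.
rewrite /=; case: (eqVneq a v) => eav; case: (eqVneq b v) => ebv /=; rewrite ?eqxx /=; try lia.
by rewrite eav ebv eqxx in ab.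
Qed.

Lemma plug_cut n t T a b c d E X m :
  gadget m t T ->
  cut (plug n t T [:: (a, b), (c, d) & E]) X =
  local_cut t T [:: X a; X b; X c; X d] [seq X (n + i) | i <- iota 0 m] + cut E X.
Proof.
case: t => [[[t0 t1] t2] t3] /and3P[ /and5P[l0 l1 l2 l3 _] bT _].
rewrite /plug /local_cut !cut_cons /= cut_cat cut_shift.
have nthz i : i < m -> nth false [seq X (n + i) | i <- iota 0 m] i = X (n + i).
  by move=> ltim; rewrite (nth_map 0) ?size_iota // nth_iota.
rewrite !nthz // (eq_cut (Y := nth false [seq X (n + i) | i <- iota 0 m]) bT) ?addnA //.
by move=> i /nthz->.
Qed.

Lemma deg_cons p E v : deg (p :: E) v = (p.1 == v) + (p.2 == v) + deg E v.
Proof. by rewrite /deg /=; lia. Qed.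

Lemma deg_cat E F v : deg (E ++ F) v = deg E v + deg F v.
Proof. by rewrite /deg !count_cat; lia. Qed.

Lemma deg_shift_old n T v : v < n -> deg (shift n T) v = 0.
Proof.
move=> lt_vn; rewrite /deg /shift !count_map; apply/eqP.
rewrite addn_eq0; apply/andP; split; rewrite -leqn0 leqNgt -has_count;
  by apply/hasPn=> p _ /=; rewrite gtn_eqF // ltn_addr.
Qed.

Lemma deg_shift n T i : deg (shift n T) (n + i) = deg T i.
Proof.
by rewrite /deg /shift !count_map; congr (_ + _); apply: eq_count => p /=; rewrite eqn_add2l.
Qed.

Lemma deg_bounded n E v : bounded n E -> n <= v -> deg E v = 0.
Proof.
move=> /allP bE le_nv; apply/eqP.
rewrite addn_eq0; apply/andP; split; rewrite -leqn0 leqNgt -has_count;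
  by apply/hasPn=> p /bE/andP[p1 p2]; rewrite ltn_eqF // (leq_trans _ le_nv).
Qed.

Lemma count_iota_shift X n m :
  count X (iota 0 (n + m)) =
  count X (iota 0 n) + count id [seq X (n + i) | i <- iota 0 m].
Proof. by rewrite iotaD count_cat add0n -[n in iota n m]addn0 iotaDl !count_map. Qed.

Lemma count_predC_iota X n : count (predC X) (iota 0 n) = n - count X (iota 0 n).
Proof. by rewrite -[X in X - _](size_iota 0) -(count_predC X) addKn. Qed.

Section Plug.

Variables (n m : nat) (t : nat * nat * nat * nat) (T E : seq edge) (a b c d : nat).
Hypothesis gT : gadget m t T.
Hypothesis goodE : good n [:: (a, b), (c, d) & E].
Hypothesis uniq_abcd : uniq [:: a; b; c; d].

Let P := plug n t T [:: (a, b), (c, d) & E].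

Lemma plug_bounded : bounded (n + m) P.
Proof.
rewrite /P; move: gT; case: t => [[[t0 t1] t2] t3] /and3P[/and5P[l0 l1 l2 l3 _] bT _].
have [/and3P[/andP[/= la lb] /andP[/= lc ld] bE] _ _ _] := goodE.
have lt_o v : v < n -> v < n + m by move=> lt_vn; rewrite ltn_addr.
rewrite /bounded /= !ltn_add2l l0 l1 l2 l3 !lt_o //= all_cat; apply/andP; split.
  by rewrite all_map; apply: sub_all bT => p /=; rewrite !ltn_add2l.
by apply: sub_all bE => p /andP[p1 p2]; rewrite !lt_o.
Qed.

Lemma plug_loopless : loopless P.
Proof.
rewrite /P; move: gT; case: t => [[[t0 t1] t2] t3] /and4P[_ bT lT _].
have [/and3P[/andP[/= la lb] /andP[/= lc ld] bE] /and3P[_ _ lE] _ _] := goodE.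
have ne_no v i : v < n -> (n + i == v) = false by move=> lt_vn; rewrite gtn_eqF ?ltn_addr.
rewrite /loopless /= ![_ == n + _]eq_sym !ne_no //= all_cat [all _ E]lE andbT all_map.
by apply: sub_all lT => p /=; rewrite eqn_add2l.
Qed.

Lemma plug_deg v : v < n + m -> deg P v = 3.
Proof.
have [/and3P[/andP[/= la lb] /andP[/= lc ld] bE] _ degE _] := goodE.
rewrite /P; move: gT; case: t => [[[t0 t1] t2] t3] /and5P[/and5P[l0 l1 l2 l3 _] bT lT /allP dT _].
have ne_no u i : u < n -> (n + i == u) = false by move=> lt_vn; rewrite gtn_eqF ?ltn_addr.
have ne_on u i : u < n -> (u == n + i) = false by move=> lt_vn; rewrite ltn_eqF ?ltn_addr.
rewrite /plug /= !deg_cons deg_cat /=; case: (ltnP v n) => [lt_vn _ | le_nv lt_v].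
  by have := degE v lt_vn; rewrite !deg_cons deg_shift_old //= !ne_no //; lia.
have [i def_v] : exists i, v = n + i by exists (v - n); rewrite subnKC.
move: lt_v; rewrite def_v ltn_add2l => lt_im.
rewrite deg_shift (deg_bounded bE) ?leq_addr // !eqn_add2l !ne_on //.
by have := dT i; rewrite mem_iota => /(_ lt_im)/eqP /=; lia.
Qed.

Lemma count_abcd (X : pred nat) : count X (iota 0 n) <= 1 -> count id [:: X a; X b; X c; X d] <= 1.
Proof.
have [/and3P[/andP[/= la lb] /andP[/= lc ld] bE] _ _ _] := goodE.
move=> cX; suff : count X [:: a; b; c; d] <= 1 by [].
apply: leq_trans cX; rewrite -!size_filter; apply: uniq_leq_size.
  by rewrite filter_uniq.
move=> x; rewrite !mem_filter mem_iota !inE => /andP[-> /=].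
by case/or4P=> /eqP->.
Qed.

(** If X has two or more old vertices, the old cut has four edges and does not shrink. With one old
    vertex the old cut has three edges and grows, and with none the gadget alone supplies four. *)
Lemma plug_cut_ge4 (X : pred nat) : count X (iota 0 n) + 2 <= n ->
  1 < count X (iota 0 (n + m)) -> 4 <= cut P X.
Proof.
have [/and3P[_ _ bE] lE degE connE] := goodE.
rewrite count_iota_shift /P => leX gtX; rewrite (plug_cut _ _ _ _ _ _ _ gT).
set y := [:: X a; X b; X c; X d]; set z := map _ _ in gtX *.
have sz_z : size z = m by rewrite size_map size_iota.
move: gT => /=; case: t => [[[t0 t1] t2] t3] /and5P[_ _ _ _ /all_bitsP/(_ y erefl)/all_bitsP/(_ z
  sz_z)].
set t' := (_, _) => /and3P[le_strands c0 c1].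
have cutE : cut [:: (a, b), (c, d) & E] X = strands_cut y + cut E X.
  by rewrite !cut_cons addnA.
case: (ltngtP (count X (iota 0 n)) 1) => [lt1 | gt1 | eq1].
- have X0 : count X (iota 0 n) = 0 by lia.
  have y0 : count id y = 0.
    have [/and3P[/andP[/= la lb] /andP[/= lc ld] _] _ _ _] := goodE.
    have /hasPn nX : ~~ has X (iota 0 n) by rewrite has_count X0.
    have nX' v : v < n -> X v = false by move=> lt_vn; apply: negPf (nX v _); rewrite mem_iota.
    by rewrite /= !nX'.
  by move: c0; rewrite y0 /= => /implyP/(_ _)/leq_trans->//; [lia | rewrite leq_addr].
- by have := connE X gt1 leX; rewrite cutE; lia.
have : size [seq x <- iota 0 n | X x] = 1 by rewrite size_filter.
case def_v: [seq x <- iota 0 n | X x] => [|v [|//]] // _.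
have memX i : i < n -> X i = (i == v).
  by move=> lt_in; rewrite -[RHS]mem_seq1 -def_v mem_filter mem_iota /= add0n lt_in andbT.
have lt_vn : v < n.
  by have := mem_head v [::]; rewrite -def_v mem_filter mem_iota => /and3P[].
have [bE' _ _ _] := goodE.
(* On old vertices X is the singleton of [v], whose cut is the degree of [v]. *)
have cut3 : cut [:: (a, b), (c, d) & E] X = 3.
  by rewrite (eq_cut (Y := pred1 v) bE') // cut1 // degE.
move: c1; rewrite count_abcd ?eq1 // => /implyP/(_ _)-le4.
by rewrite -[4]/3.+1 -cut3 cutE -addSn leq_add2r le4 //; lia.
Qed.

(** If fewer than two old vertices lie outside X, the complement of X has the same cut and satisfies
    the hypotheses of [plug_cut_ge4]. *)
Lemma plug_well_connected : 3 < n -> well_connected (n + m) P.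
Proof.
move=> gt3n X gtX leX; case: (leqP (count X (iota 0 n) + 2) n) => [le2 | gt2].
  exact: plug_cut_ge4.
have le_cX : count X (iota 0 n) <= n by rewrite -[X in _ <= X](size_iota 0) count_size.
by rewrite -cutC; apply: plug_cut_ge4; rewrite count_predC_iota; lia.
Qed.

Lemma plug_good : 3 < n -> good (n + m) P.
Proof.
move=> gt3n; split; first exact: plug_bounded; first exact: plug_loopless.
  exact: plug_deg.
exact: plug_well_connected.
Qed.

End Plug.

(** * Inserting the Petersen graph minus two adjacent vertices *)

(** A dangling edge [(t, t)] is covered by every edge at [t], so a piece with dangling edges can be
    embedded where these continue as full edges. *)
Definition covers (q p : edge) : bool := all (fun v => (v == q.1) || (v == q.2)) [:: p.1; p.2].

Lemma share_covers p p' q q' : covers q p -> covers q' p' -> share p p' -> share q q'.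
Proof.
move=> /and3P[/orP[] /eqP e1 /orP[] /eqP e2 _] /and3P[/orP[] /eqP e3 /orP[] /eqP e4 _];
by rewrite /share e1 e2 e3 e4 => /or4P[] /eqP->; rewrite eqxx ?orbT.
Qed.

Lemma embeds_covers T L m :
  (forall i, i < size T -> m i < size L /\ covers (nth point0 L (m i)) (nth point0 T i)) ->
  {in gtn (size T) &, injective m} -> embeds T L m.
Proof.
move=> cov inj i j hi hj ne sh; have [mi ci] := cov i hi; have [mj cj] := cov j hj.
by split=> //; [apply: contraNneq ne => /inj-> | apply: share_covers ci cj sh].
Qed.

Lemma share_shift n p q : share (n + p.1, n + p.2) (n + q.1, n + q.2) = share p q.
Proof. by rewrite /share /= !eqn_add2l. Qed.

Lemma embeds_shift n T : embeds T (shift n T) id.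
Proof.
move=> i j hi hj ne sh; split; rewrite ?size_map //.
by rewrite !(nth_map point0) // share_shift.
Qed.

Definition p8_terminals : nat * nat * nat * nat := (6, 7, 2, 5).

Lemma p8_gadget : gadget 8 p8_terminals p8_inner.
Proof. by vm_compute. Qed.

(* A strand of [p8] keeps its colour when the two strands start with adjacent colours. *)
Lemma p8_strands x y z w : [:: y; z; w] \in rows 3 x -> padj x z -> y = x /\ w = z.
Proof.
move=> in_rows adj_xz.
have /allP/(_ x)/[!mem_iota]/(_ (padj_lt adj_xz))/allP/(_ _ in_rows)/implyP/(_ adj_xz)/andP[/eqP
  eq_y /eqP eq_w] :
  all (fun x => all (fun r => padj x (nth 0 r 1) ==>
    (nth 0 r 0 == x) && (nth 0 r 2 == nth 0 r 1)) (rows 3 x)) (iota 0 15) by vm_compute.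
by split.
Qed.

Section PlugP8.

Variables (n a b c d : nat) (E : seq edge).
Let E1 := [:: (a, b), (c, d) & E].
Let P := plug n p8_terminals p8_inner E1.

Lemma tight_plug : tight E1 -> tight P.
Proof.
move=> tE k pk.
have halvesE : halves E1 = [:: (a, a); (b, b); (c, c); (d, d)] ++ E by rewrite /halves /= drop0.
have halvesP : halves P = [:: (n + 7, n + 7); (b, b); (n + 5, n + 5); (d, d);
  (a, n + 6); (c, n + 2)] ++ shift n p8_inner ++ E by rewrite /halves /P /= ?drop0.
(* The edges from [a] and [c] into the gadget, at 4 and 5, play the old first halves; the second
   halves remain. The rest of [E] moves from position 4 to 16. *)
pose m i := if i < 4 then nth 0 [:: 4; 1; 5; 3] i else i + 12.
(* The strands of the new [p8] lead from 4 to 0 and from 5 to 2; its ten inner edges start at 6. *)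
pose m8 := nth 0 ([:: 4; 0; 5; 2] ++ iota 6 10).
have emb : embeds (halves E1) (halves P) m.
  apply: embeds_covers => [i|i j].
    rewrite halvesE halvesP /m.
    case: i => [|[|[|[|i]]]] hi; rewrite ?addSn ?addnS ?addn0 /covers /=; rewrite ?eqxx ?orbT //.
  by rewrite /m => _ _; case: i j => [|[|[|[|i]]]] [|[|[|[|j]]]] //=; rewrite ?addnS ?addn0 //= =>
    -[] //; lia.
have emb8 : embeds p8 (halves P) m8.
  have emb8' : embeds (shift n p8) (halves P) m8.
    apply: embeds_covers => [i hi|i j hi hj /eqP]; last first.
      by rewrite nth_uniq //= => /eqP.
    rewrite halvesP.
    by do 14![case: i hi => [|i] hi; first by rewrite /covers /= ?eqxx ?orbT].
  move=> i j hi hj ne sh; have [? ? ne' sh'] := embeds_shift n hi hj ne sh.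
  exact: (emb8' i j).
have [adj45 ne] := tE _ (proper_embeds emb pk).
(* The colours at 4 and 5 are adjacent by tightness of [E1], so the strands pass them on to the new
   first halves. *)
have [e0 e2] := p8_strands (p8_rows (proper_embeds emb8 pk)) adj45.
rewrite /= /m /m8 /= in e0 e2 adj45 ne.
by rewrite e0 e2.
Qed.

End PlugP8.

(** * Parallel edges and short cycles *)

Definition norm (p : edge) : edge := if p.1 <= p.2 then p else (p.2, p.1).

Definition simple (E : seq edge) : bool := uniq (map norm E).

Definition adjl (E : seq edge) : rel nat := fun x y => ((x, y) \in E) || ((y, x) \in E).

Definition no_cycle34 (r : rel nat) : Prop :=
  (forall x y z, r x y -> r y z -> r z x -> False) /\
  (forall x y z w, r x y -> r y z -> r z w -> r w x -> x != z -> y != w -> False).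

Definition girth_ge5 (E : seq edge) : Prop := no_cycle34 (adjl E).

Definition pentagon (E : seq edge) (c : seq nat) : bool :=
  [&& size c == 5, uniq c & cycle (adjl E) c].

Lemma adjl_sym E x y : adjl E x y = adjl E y x.
Proof. exact: orbC. Qed.

Lemma adjl_cat E F x y : adjl (E ++ F) x y = adjl E x y || adjl F x y.
Proof. by rewrite /adjl !mem_cat orbACA. Qed.

Lemma adjl_bounded n E x y : bounded n E -> adjl E x y -> (x < n) && (y < n).
Proof. by move=> /allP bE /orP[] /bE/andP[/= -> ->]. Qed.

Lemma adjl_neq E x y : loopless E -> adjl E x y -> x != y.
Proof. by move=> /allP lE /orP[] /lE //=; rewrite eq_sym. Qed.

Definition nbrs (E : seq edge) (x : nat) : seq nat :=
  [seq p.2 | p <- E & p.1 == x] ++ [seq p.1 | p <- E & p.2 == x].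

Lemma mem_nbrs E x y : (y \in nbrs E x) = adjl E x y.
Proof.
rewrite mem_cat; congr (_ || _).
  by apply/mapP/idP=> [[[u v]] | xyE]; [rewrite mem_filter => /andP[/eqP/= -> ?] -> |
    exists (x, y); rewrite // mem_filter eqxx].
by apply/mapP/idP=> [[[u v]] | xyE]; [rewrite mem_filter => /andP[/eqP/= -> ?] -> |
  exists (y, x); rewrite // mem_filter eqxx].
Qed.

(** With tabulated neighbours the test follows walks of three steps from each vertex instead of
    running through all quadruples. *)
Definition girth_ge5b (n : nat) (E : seq edge) : bool :=
  let table := [seq nbrs E x | x <- iota 0 n] in
  let N := nth [::] table in
  all (fun x => let Nx := N x in all (fun y => all (fun z => (z != x) ==>
    (z \notin Nx) && all (fun w => (w != y) ==> (w \notin Nx)) (N z)) (N y)) Nx) (iota 0 n).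

Lemma girth_ge5P n E : bounded n E -> loopless E -> girth_ge5b n E -> girth_ge5 E.
Proof.
move=> bE lE /allP h.
have NE x : x < n -> nth [::] [seq nbrs E x | x <- iota 0 n] x = nbrs E x.
  by move=> ltx; rewrite (nth_map 0) ?size_iota // nth_iota.
have h2 x y z : adjl E x y -> adjl E y z -> z != x ->
    (z \notin nbrs E x) && all (fun w => (w != y) ==> (w \notin nbrs E x)) (nbrs E z).
  move=> xy yz zx; have /andP[ltx lty] := adjl_bounded bE xy.
  have /andP[_ ltz] := adjl_bounded bE yz.
  have := h x; rewrite mem_iota => /(_ ltx); rewrite /= NE // => /allP/(_ y).
  rewrite mem_nbrs NE // => /(_ xy)/allP/(_ z).
  by rewrite mem_nbrs NE // => /(_ yz)/implyP/(_ zx).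
split=> [x y z xy yz zx | x y z w xy yz zw wx xz yw].
  have /andP[] := h2 x y z xy yz (adjl_neq lE zx).
  by rewrite mem_nbrs adjl_sym zx.
have zx : z != x by rewrite eq_sym.
have /andP[_ /allP/(_ w)] := h2 x y z xy yz zx.
by rewrite !mem_nbrs => /(_ zw); rewrite eq_sym yw adjl_sym wx.
Qed.

Definition stub (n : nat) (t : nat * nat * nat * nat) (a b c d x j : nat) : bool :=
  let: (t0, t1, t2, t3) := t in (x, j) \in [:: (a, t0); (b, t1); (c, t2); (d, t3)].

Lemma adjl_shift n T x y :
  adjl (shift n T) x y = [&& n <= x, n <= y & adjl T (x - n) (y - n)].
Proof.
have memS u v : ((u, v) \in shift n T) = [&& n <= u, n <= v & (u - n, v - n) \in T].
  apply/mapP/and3P=> [[[i j] ijT [-> ->]] | [leu lev uvT]].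
    by rewrite !leq_addr !addKn.
  by exists (u - n, v - n); rewrite //= !subnKC.
by rewrite /adjl !memS; case: (n <= x); case: (n <= y); rewrite //= andbF.
Qed.

Section PlugGirth.

Variables (n a b c d : nat) (t : nat * nat * nat * nat) (T E : seq edge).
Let E1 := [:: (a, b), (c, d) & E].
Let P := plug n t T E1.
Hypothesis boundE : bounded n E1.

Lemma adjl_plug x y : adjl P x y ->
  [|| [&& x < n, y < n & adjl E1 x y],
      [&& x < n, n <= y & stub n t a b c d x (y - n)],
      [&& n <= x, y < n & stub n t a b c d y (x - n)]
    | [&& n <= x, n <= y & adjl T (x - n) (y - n)]].
Proof.
have [/andP[/= la lb] /andP[/= lc ld] bE] := and3P boundE.
rewrite /P; case: t => [[[t0 t1] t2] t3].
rewrite /plug !adjl_cat adjl_shift => /or3P[|->|xyE]; last first.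
- by have /andP[-> ->] := adjl_bounded bE xyE; move: xyE; rewrite /adjl !inE => /orP[] ->; rewrite
  ?orbT.
- by rewrite !orbT.
rewrite /adjl /stub !inE -!orbA.
by do !case/orP; (try by []); case/eqP=> -> ->;
  rewrite ?leq_addr ?la ?lb ?lc ?ld ?addKn ?eqxx ?orbT // ltnNge leq_addr.
Qed.

End PlugGirth.

(* Two graphs without triangles and squares, joined by a matching [S] whose ends in the
   second graph are pairwise nonadjacent. *)
Lemma no_cycle34_glue n (r old new S : rel nat) :
  (forall x y, r x y ->
    if x < n then (if y < n then old x y else S x (y - n))
    else (if y < n then S y (x - n) else new (x - n) (y - n))) ->
  (forall x y j, S x j -> S y j -> x = y) -> (forall x i j, S x i -> S x j -> i = j) ->
  (forall x y i j, S x i -> S y j -> new i j -> False) ->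
  (forall x y, old x y -> x != y) -> no_cycle34 old -> no_cycle34 new -> no_cycle34 r.
Proof.
move=> rP Sl Sr Sfar old_ne [E3 E4] [T3 T4].
have subn_inj x y : n <= x -> n <= y -> x != y -> x - n != y - n.
  by move=> hx hy; apply: contraNneq => exy; rewrite -(subnK hx) exy subnK.
(* A triangle or square with vertices on both sides uses two edges of [S] with a common end, against
   the matching, or two whose new ends are adjacent, against [Sfar]. *)
split=> [x y z | x y z w].
  move=> /rP + /rP + /rP.
  case: (ltnP x n) => hx; case: (ltnP y n) => hy; case: (ltnP z n) => hz xy yz zx;
    solve [ exact: E3 xy yz zx | exact: T3 xy yz zx
          | exact: Sfar xy zx yz | exact: Sfar xy yz zx | exact: Sfar yz zx xy
          | exact: Sfar zx xy yz | exact: Sfar yz xy zx | exact: Sfar zx yz xy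
          | by move: (old_ne _ _ xy); rewrite (Sl _ _ _ yz zx) eqxx
          | by move: (old_ne _ _ yz); rewrite (Sl _ _ _ xy zx) eqxx
          | by move: (old_ne _ _ zx); rewrite (Sl _ _ _ xy yz) eqxx ].
move=> /rP + /rP + /rP + /rP.
case: (ltnP x n) => hx; case: (ltnP y n) => hy; case: (ltnP z n) => hz; case: (ltnP w n) => hw;
  move=> xy yz zw wx xz yw;
  solve [ exact: E4 xy yz zw wx xz yw
        | exact: T4 xy yz zw wx (subn_inj _ _ hx hz xz) (subn_inj _ _ hy hw yw)
        | by move: xz; rewrite (Sl _ _ _ xy yz) eqxx
        | by move: xz; rewrite (Sl _ _ _ wx zw) eqxx
        | by move: yw; rewrite (Sl _ _ _ xy wx) eqxx
        | by move: yw; rewrite (Sl _ _ _ yz zw) eqxx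
        | by move: (subn_inj _ _ hy hw yw); rewrite (Sr _ _ _ xy wx) eqxx
        | by move: (subn_inj _ _ hy hw yw); rewrite (Sr _ _ _ yz zw) eqxx
        | by move: (subn_inj _ _ hx hz xz); rewrite (Sr _ _ _ xy yz) eqxx
        | by move: (subn_inj _ _ hx hz xz); rewrite (Sr _ _ _ wx zw) eqxx
        | exact: Sfar xy zw yz | exact: Sfar zw xy yz
        | exact: Sfar xy zw wx | exact: Sfar zw xy wx
        | exact: Sfar yz wx xy | exact: Sfar wx yz xy
        | exact: Sfar yz wx zw | exact: Sfar wx yz zw ].
Qed.

Section PlugSimple.

Variables (n a b c d : nat) (t0 t1 t2 t3 : nat) (T E : seq edge).
Let t := (t0, t1, t2, t3).
Let E1 := [:: (a, b), (c, d) & E].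
Let P := plug n t T E1.
Let stb := stub n t a b c d.
Hypothesis boundE : bounded n E1.
Hypothesis looplessE : loopless E1.
Hypothesis uniq_abcd : uniq [:: a; b; c; d].
Hypothesis uniq_t : uniq [:: t0; t1; t2; t3].

Lemma stub_inj_l x y j : stb x j -> stb y j -> x = y.
Proof.
rewrite /stb /stub /t !inE !xpair_eqE.
case/or4P=> /andP[/eqP-> /eqP->] /or4P[]/andP[/eqP-> /eqP e] //;
  by move: uniq_t; rewrite /= !inE e eqxx ?orbT ?andbF.
Qed.

Lemma stub_inj_r x i j : stb x i -> stb x j -> i = j.
Proof.
rewrite /stb /stub /t !inE !xpair_eqE.
case/or4P=> /andP[/eqP-> /eqP->] /or4P[]/andP[/eqP e /eqP->] //;
  by move: uniq_abcd; rewrite /= !inE e eqxx ?orbT ?andbF.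
Qed.

Lemma stub_terminal x j : stb x j -> j \in [:: t0; t1; t2; t3].
Proof. by rewrite /stb /stub /t !inE; case/or4P=> /eqP[_ ->]; rewrite eqxx ?orbT. Qed.

Lemma adjl_plug_if x y : adjl P x y ->
  if x < n then (if y < n then adjl E1 x y else stb x (y - n))
  else (if y < n then stb y (x - n) else adjl T (x - n) (y - n)).
Proof.
move/(adjl_plug boundE); case: (ltnP x n) => hx; case: (ltnP y n) => hy;
  by rewrite /= ?orbF ?andbF ?orbF.
Qed.

Hypothesis far_t : {in [:: t0; t1; t2; t3] &, forall i j, ~~ adjl T i j}.
Hypothesis looplessT : loopless T.
Hypothesis girthE : girth_ge5 E1.
Hypothesis girthT : girth_ge5 T.

Lemma plug_girth : girth_ge5 P.
Proof.
apply: (no_cycle34_glue adjl_plug_if stub_inj_l stub_inj_r _ _ girthE girthT) => [x y i j|x y].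
  by move=> /stub_terminal hi /stub_terminal hj; apply/negP/far_t.
exact: adjl_neq.
Qed.

Lemma norm_shift p : norm (n + p.1, n + p.2) = (n + (norm p).1, n + (norm p).2).
Proof. by rewrite /norm /= leq_add2l; case: ifP. Qed.

Lemma norm_old p : p.1 < n -> p.2 < n -> ((norm p).1 < n) && ((norm p).2 < n).
Proof. by rewrite /norm; case: ifP => _ -> ->. Qed.

(** Old edges have both ends below [n], gadget edges neither, joining edges exactly one; so a
    repetition would have to occur inside one of these classes. *)
Lemma plug_simple : simple E1 -> simple T -> simple P.
Proof.
have [/andP[/= la lb] /andP[/= lc ld] /allP bE] := and3P boundE.
move=> /= /and3P[_ _ uE] uT; have {}uE : uniq (map norm E) := uE.
have normS v i : v < n -> norm (v, n + i) = (v, n + i).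
  by move=> lt_vn; rewrite /norm /= ltnW // ltn_addr.
have normS' v i : v < n -> norm (n + i, v) = (v, n + i).
  by move=> lt_vn; rewrite /norm /= leqNgt ltn_addr.
rewrite /simple /P /plug !map_cat !cat_uniq uE andbT.
have defT : map norm (shift n T) = shift n (map norm T).
  by rewrite /shift -!map_comp; apply: eq_map => p; apply: norm_shift.
have uS : uniq (shift n (map norm T)).
  rewrite map_inj_uniq //.
  by move=> [i j] [k l] /eqP; rewrite xpair_eqE !eqn_add2l /= => /andP[/eqP-> /eqP->].
rewrite defT uS.
have noE p : p \in map norm E -> p.2 < n by case/mapP=> q /bE/andP[q1 q2] ->; case/andP: (norm_old
  q1 q2).
have noS p : p \in shift n (map norm T) -> n <= p.1 by case/mapP=> q _ ->; rewrite leq_addr.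
apply/and4P; split=> //.
- rewrite /= !normS // !normS' // !inE !xpair_eqE !negb_or.
  by do ![apply/andP; split] => //; apply/negP => /andP[/eqP e _];
    move: uniq_abcd; rewrite e /= !inE eqxx ?orbT ?andbF.

- rewrite has_cat negb_or; apply/andP; split; apply/hasPn=> p.
    by move=> /noS le_np; rewrite /= !normS // !normS' // !inE; apply/negP => /or4P[]/eqP ep;
      rewrite ep leqNgt /= ?la ?lb ?lc ?ld in le_np.
  by move=> /noE; rewrite /= !normS // !normS' // !inE ltnNge; apply: contraNN => /or4P[]/eqP->;
    rewrite leq_addr.
- by apply/hasPn=> p /noE; rewrite ltnNge; apply: contraNN => /mapP[q _ ->]; rewrite leq_addr.
Qed.

Lemma plug_pentagon u : pentagon T u -> pentagon P (map (addn n) u).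
Proof.
case/and3P=> su uu cu; apply/and3P; split; first by rewrite size_map.
  by rewrite map_inj_uniq //; apply: addnI.
move: su cu; case: u uu => [|v0 [|v1 [|v2 [|v3 [|v4 [|]]]]]] //= _ _.
have adjP i j : adjl T i j -> adjl P (n + i) (n + j).
  by move=> ij; rewrite /P /plug !adjl_cat adjl_shift !leq_addr !addKn ij orbT.
by case/and5P=> /adjP-> /adjP-> /adjP-> /adjP-> /andP[/adjP-> _].
Qed.

End PlugSimple.

(** * From edge lists to graphs *)

(** The invariant of the induction in steps of eight vertices; the two tight edges stand first,
    where [plug] acts. *)
Definition witness (n : nat) (E : seq edge) : Prop :=
  [/\ 3 < n, good n E, simple E, girth_ge5 E & exists u, pentagon E u] /\
  exists e f E', [/\ E = [:: e, f & E'], uniq [:: e.1; e.2; f.1; f.2] & tight E].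

Lemma p8_girth : girth_ge5 p8_inner.
Proof. by apply: (@girth_ge5P 8); vm_compute. Qed.

Lemma witness_plug n E : witness n E -> witness (n + 8) (plug n p8_terminals p8_inner E).
Proof.
move=> [[gt3n goodE simpleE girthE _] [[a b] [[c d] [E' [defE uniqE tightE]]]]].
subst E; have [bE lE _ _] := goodE; split; last first.
  (* The next pair to be cut consists of the edges by which the two strands leave the new [p8]. *)
  exists (n + 7, b), (n + 5, d), [:: (a, n + 6), (c, n + 2) & shift n p8_inner ++ E'].
  split=> //; last exact: tight_plug.
  have [/andP[/= la lb] /andP[/= lc ld] _] := and3P bE.
  move: uniqE; rewrite /= !inE !negb_or => /and4P[_ /andP[_ bd] _ _].
  by apply/and4P; split; lia.
split.
- by rewrite ltn_addr.
- exact: plug_good p8_gadget goodE uniqE gt3n.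
- exact: plug_simple.
- apply: (plug_girth bE lE uniqE) => //; last exact: p8_girth.
  (* The terminals are the neighbours of the two vertices removed from P; an edge between them would
     close a triangle or a square in P. *)
  have /allP h : all (fun i => all (fun j => ~~ adjl p8_inner i j) [:: 6; 7; 2; 5]) [:: 6; 7; 2; 5].
    by vm_compute.
  by move=> i j /h/allP; apply.
(* A pentagon inside [p8_inner]. *)
- by exists (map (addn n) [:: 0; 4; 2; 3; 7]); apply: plug_pentagon.
Qed.

Lemma witness_iter n E k : witness n E -> exists E', witness (n + 8 * k) E'.
Proof.
move=> wE; elim: k => [|k [E' IH]]; first by exists E; rewrite muln0 addn0.
by exists (plug (n + 8 * k) p8_terminals p8_inner E'); rewrite mulnS addnCA addnC; apply:
  witness_plug.
Qed.

Lemma norm_swap u v : norm (u, v) = norm (v, u).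
Proof. by rewrite /norm /=; case: ltngtP => // ->. Qed.

Section Graph.

Variables (n : nat) (E : seq edge).

Definition list_rel : rel 'I_n := fun x y => (x != y) && adjl E x y.

Lemma list_rel_sym : symmetric list_rel.
Proof. by move=> x y; rewrite /list_rel eq_sym adjl_sym. Qed.

Lemma list_rel_irrefl : irreflexive list_rel.
Proof. by move=> x; rewrite /list_rel eqxx. Qed.

Definition list_graph : sgraph := SGraph list_rel_sym list_rel_irrefl.

Definition list_edge (p : edge) : {set list_graph} :=
  [set x : 'I_n | (x == p.1 :> nat) || (x == p.2 :> nat)].

Hypothesis wE : witness n E.

Let bE : bounded n E. Proof. by case: wE => -[_ []]. Qed.
Let lE : loopless E. Proof. by case: wE => -[_ []]. Qed.
Let degE v : v < n -> deg E v = 3. Proof. by case: wE => -[_ [_ _ h _] _ _ _] _; apply: h. Qed.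
Let connE : well_connected n E. Proof. by case: wE => -[_ []]. Qed.
Let simpleE : simple E. Proof. by case: wE => -[]. Qed.
Let girthE : girth_ge5 E. Proof. by case: wE => -[]. Qed.

Lemma list_graphE (x y : list_graph) : sedge x y = adjl E x y.
Proof.
rewrite /sedge /= /list_rel; case: eqVneq => [->|//].
by apply/esym/negP => /(adjl_neq lE); rewrite eqxx.
Qed.

Lemma norm_inj : {in E &, injective norm}.
Proof.
move=> p q pE qE eq_pq; rewrite -(nth_index point0 pE) -(nth_index point0 qE); congr nth.
apply/eqP; rewrite -(nth_uniq point0 _ _ simpleE) ?size_map ?index_mem //.
by rewrite !(nth_map point0) ?index_mem // !nth_index // eq_pq.
Qed.

Lemma list_edge_inj : {in E &, injective list_edge}.
Proof.
move=> p q pE qE eq_pq.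
have /allP hb := bE; have /andP[p1 p2] := hb _ pE; have /andP[q1 q2] := hb _ qE.
have normed : norm p = norm q.
  have eqv v : v < n -> (v == p.1) || (v == p.2) = (v == q.1) || (v == q.2).
    by move=> lt_vn; have /setP/(_ (Ordinal lt_vn)) := eq_pq; rewrite !inE.
  have /allP/(_ _ pE) := lE; have := eqv _ p1; have := eqv _ p2; rewrite !eqxx orbT /=.
  move=> /esym e2 /esym e1 ne_p.
  rewrite [p]surjective_pairing [q]surjective_pairing.
  case/orP: e1 => /eqP e1; case/orP: e2 => /eqP e2; rewrite e1 e2 ?eqxx // in ne_p *.
  exact: norm_swap.
exact: norm_inj normed.
Qed.

(** This turns the count of edges in [deg] into a count of distinct neighbours: a repetition would
    come from parallel edges or a loop. *)
Lemma nbrs_uniq x : uniq (nbrs E x).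
Proof.
have uE : uniq E := map_uniq simpleE.
rewrite cat_uniq !map_inj_in_uniq ?filter_uniq //; last 2 first.
- by move=> [u v] [u' v']; rewrite !mem_filter /= => /andP[/eqP-> _] /andP[/eqP-> _] ->.
- by move=> [u v] [u' v']; rewrite !mem_filter /= => /andP[/eqP-> _] /andP[/eqP-> _] ->.
rewrite andbT; apply/hasPn=> y /mapP[[u v]]; rewrite mem_filter => /andP[/eqP /= -> yxE] ->.
apply/negP=> /mapP[[u' v']]; rewrite mem_filter => /andP[/eqP /= -> xyE] eq_uv'.
rewrite -eq_uv' in xyE; have /allP/(_ _ yxE) /= := lE.
by have [-> _] := norm_inj yxE xyE (norm_swap _ _); rewrite eqxx.
Qed.

Lemma list_graph_cubic : cubic list_graph.
Proof.
move=> x; rewrite -[3]/(3) -(degE (ltn_ord x)).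
have -> : deg E x = size (nbrs E x) by rewrite /deg /nbrs size_cat !size_map !size_filter.
rewrite cardE -(size_map val); apply/perm_size/uniq_perm; rewrite ?nbrs_uniq //.
  by rewrite map_inj_uniq ?enum_uniq //; apply: val_inj.
move=> y; rewrite mem_nbrs; apply/mapP/idP => [[z] | xyE].
  by rewrite mem_enum inE list_graphE => xz ->.
have /andP[_ lt_yn] := adjl_bounded bE xyE.
by exists (Ordinal lt_yn); rewrite // mem_enum inE list_graphE.
Qed.

Lemma list_edge_mem p : p \in E ->
  exists x y : list_graph, [/\ p = (nat_of_ord x, nat_of_ord y), sedge x y & list_edge p = [set x;
    y]].
Proof.
have /allP hb := bE; move=> pE; have /andP[p1 p2] := hb _ pE.
exists (Ordinal p1), (Ordinal p2); split; first exact: surjective_pairing.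
  by rewrite list_graphE /adjl /= -surjective_pairing pE.
by apply/setP=> z; rewrite !inE -!val_eqE.
Qed.

Lemma list_edges p : p \in E -> list_edge p \in edges list_graph.
Proof.
move=> /list_edge_mem[x [y [_ xy ->]]]; apply/imset2P.
by exists x y; rewrite ?inE.
Qed.

Lemma list_graph_uncolourable : ~ exists phi : {set list_graph} -> {set petersen}, P_coloring phi.
Proof.
case=> phi [phiE phi_adj]; have [_ [e [f [E' [defE uniq_ef tE]]]]] := wE.
rewrite defE in tE.
apply: (@tight_uncolourable e f E' (fun i => pcode (phi (list_edge (nth point0 E i)))) uniq_ef tE).
rewrite -defE => i j hi hj ne_ij sh.
have ei := mem_nth point0 hi; have ej := mem_nth point0 hj.
apply: padj_pcode; rewrite ?phiE ?list_edges //; apply: phi_adj; rewrite ?list_edges //.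
apply/andP; split.
  apply: contraNneq ne_ij => /(list_edge_inj ei ej)/eqP; rewrite nth_uniq //.
  exact: map_uniq simpleE.
have /allP hb := bE; have /andP[i1 i2] := hb _ ei.
apply/existsP; move: sh; rewrite /share => sh.
have [v hv] : exists2 v : 'I_n, (v == (nth point0 E i).1 :> nat) || (v == (nth point0 E i).2 :> nat)
  & (v == (nth point0 E j).1 :> nat) || (v == (nth point0 E j).2 :> nat).
  by case/or4P: sh => /eqP sh; [exists (Ordinal i1) | exists (Ordinal i1) | exists (Ordinal i2) |
    exists (Ordinal i2)];
    rewrite /= ?eqxx ?orbT // sh eqxx ?orbT.
by move=> hv'; exists v; rewrite !inE hv.
Qed.

Lemma list_cycle (c : seq list_graph) :
  cycle (@sedge list_graph) c = cycle (adjl E) (map (@nat_of_ord n) c).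
Proof. by rewrite cycle_map; apply: eq_cycle => x y; apply: list_graphE. Qed.

Lemma list_graph_girth : has_girth list_graph 5.
Proof.
have [E3 E4] := girthE; split.
  have [[_ _ _ _ [u /and3P[/eqP size_u uniq_u cycle_u]]] _] := wE.
  have lt_u v : v \in u -> v < n.
    move=> /(next_cycle cycle_u) vE; by have /andP[] := adjl_bounded bE vE.
  pose w : seq 'I_n := pmap insub u.
  have def_w : map val w = u.
    rewrite /w pmap_filter; last exact: insubK.
    by apply/all_filterP/allP=> v /lt_u lt_v; rewrite insubT.
  exists w; last by rewrite -size_u -def_w size_map.
  apply/and3P; split; first by rewrite -(size_map val) def_w size_u.
    by rewrite -(map_inj_uniq val_inj) def_w.
  by rewrite list_cycle def_w.
move=> [|x [|y [|z [|w [|v c]]]]] // /and3P[_ uniq_c]; rewrite list_cycle /= => cycle_c; exfalso.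
  by have /and4P[xy yz zx _] := cycle_c; exact: E3 xy yz zx.
have /and5P[xy yz zw wx _] := cycle_c.
move: uniq_c; rewrite /= !inE !negb_or => /and4P[/and3P[_ xz _] /andP[_ yw] _ _].
exact: E4 xy yz zw wx xz yw.
Qed.

(** All edges leaving the component [C1] lie in [S]. Both components contain a cycle, hence at least
    three vertices, so [well_connected] applies to the vertex set of [C1]. *)
Lemma list_graph_connected : cyclically_edge_connected list_graph 4.
Proof.
move=> S S_E card_S [C1 [C2 [C1c C2c neC [c1 cyc1 c1C1] [c2 cyc2 c2C2]]]].
pose X : pred nat := fun v => [exists x : 'I_n, (x \in C1) && (v == x)].
have memX (x : 'I_n) : X x = (x \in C1).
  by apply/existsP/idP=> [[y /andP[yC /eqP/val_inj->]] // | xC]; exists x; rewrite xC eqxx.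
have big_cycle (c : seq 'I_n) (C : {set 'I_n}) : 2 < size c -> uniq c -> {subset c <= C} -> 2 <
  #|C|.
  move=> sz uc sub; apply: leq_trans sz _; rewrite -(card_uniqP uc).
  by apply/subset_leq_card/subsetP.
have gt2_C1 : 2 < #|(C1 : {set 'I_n})| by case/and3P: cyc1 => ? ? _; apply: (big_cycle c1).
have gt2_C2 : 2 < #|(C2 : {set 'I_n})| by case/and3P: cyc2 => ? ? _; apply: (big_cycle c2).
have countX : count X (iota 0 n) = #|(C1 : {set 'I_n})|.
  have -> : #|(C1 : {set 'I_n})| = count (mem (C1 : {set 'I_n})) (enum 'I_n).
    by rewrite enumT cardE /enum_mem size_filter.
  by rewrite -val_enum_ord count_map; apply: eq_count => x; apply: memX.
have symC : connect_sym (@sedge (del_edges S)) by exact: sym_connect_sym (@sedge_sym (del_edges S)).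
have [x0 _ defC1] := imsetP C1c; have [y0 _ defC2] := imsetP C2c.
have disj : [disjoint (C1 : {set 'I_n}) & (C2 : {set 'I_n})].
  rewrite disjoint_subset; apply/subsetP=> z xz; apply/negP=> yz; case/negP: neC.
  move: xz yz; rewrite defC1 defC2 !inE => xz yz; apply/eqP/setP=> v; rewrite !inE.
  by rewrite (same_connect symC xz) (same_connect symC yz).
have cardn : #|(C1 : {set 'I_n})| + #|(C2 : {set 'I_n})| <= n.
  have [_] := leq_card_setU (C1 : {set 'I_n}) (C2 : {set 'I_n}); rewrite disj => /eqP <-.
  by rewrite -[X in _ <= X]card_ord max_card.
suff le_cut : cut E X <= #|S|.
  have := leq_ltn_trans le_cut card_S; apply/negP; rewrite -leqNgt.
  apply: connE; rewrite countX; first exact: ltnW.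
  by apply: leq_trans cardn; rewrite leq_add2l ltnW.
rewrite /cut -size_filter -(size_map list_edge) cardE.
have uE : uniq E := map_uniq simpleE.
apply: uniq_leq_size => [|A /mapP[p]].
  rewrite map_inj_in_uniq ?filter_uniq // => p q; rewrite !mem_filter => /andP[_ pE] /andP[_ qE].
  exact: list_edge_inj.
rewrite mem_filter mem_enum => /andP[Xp /list_edge_mem[x [y [defp xy ->]]]] ->.
(* An edge outside [S] survives the deletion, so its ends lie in the same component. *)
apply: contraR Xp => xyS; rewrite defp /= !memX defC1 !inE; apply/eqP.
by apply: same_connect_r symC _ _ _ _; apply: connect1; rewrite /= /del_rel xy.
Qed.

Lemma list_graph_card : #|list_graph| = n.
Proof. exact: card_ord. Qed.

End Graph.

(** * The four small graphs *)

Definition swap (p : edge) : edge := (p.2, p.1).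

(** A move names its edge in the orientation that [plug] needs, while the list may hold the reversed
    pair. *)
Definition pick_edge (p : edge) (E : seq edge) : seq edge :=
  if p \in E then rem p E else rem (swap p) E.

Definition front (e f : edge) (E : seq edge) : seq edge :=
  [:: e, f & pick_edge f (pick_edge e E)].

Definition has_edge (p : edge) (E : seq edge) : bool := (p \in E) || (swap p \in E).

Definition can_front (e f : edge) (E : seq edge) : bool :=
  [&& has_edge e E, has_edge f (pick_edge e E) & uniq [:: e.1; e.2; f.1; f.2]].

Lemma good_perm n E F : perm_eq E F -> good n E -> good n F.
Proof.
move=> eqEF [bE lE dE cE]; split.
- by rewrite /bounded -(perm_all _ eqEF).
- by rewrite /loopless -(perm_all _ eqEF).
- by move=> v /dE; rewrite /deg !(permP eqEF).
- by move=> X ? ?; rewrite /cut -(permP eqEF); apply: cE.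
Qed.

Lemma good_swap n p E : good n (p :: E) -> good n (swap p :: E).
Proof.
move=> [/andP[bp bE] /andP[lp lE] dE cE]; split.
- by rewrite /bounded /= [_ && (p.1 < n)]andbC bp.
- by rewrite /loopless /= eq_sym lp.
- by move=> v /dE; rewrite !deg_cons /= [(_ == v) + _]addnC.
- by move=> X gtX leX; have := cE X gtX leX; rewrite !cut_cons /= [X p.2 == _]eq_sym.
Qed.

Lemma perm_pick p E : has_edge p E ->
  perm_eq E (p :: pick_edge p E) \/ perm_eq E (swap p :: pick_edge p E).
Proof.
rewrite /has_edge /pick_edge; case: ifP => [pE _ | _ /= spE].
  by left; apply: perm_to_rem.
by right; apply: perm_to_rem.
Qed.

Lemma good_pick n p E F : has_edge p E -> good n (F ++ E) -> good n (F ++ p :: pick_edge p E).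
Proof.
have mid x s : perm_eq (x :: F ++ s) (F ++ x :: s) by rewrite -cat1s perm_catCA.
case/perm_pick=> eqE gE.
  by apply: good_perm gE; rewrite perm_cat2l.
apply: good_perm (mid _ _) _; have -> : p = swap (swap p) by case: p {eqE}.
apply: good_swap; apply: good_perm gE; rewrite perm_sym (permPl (mid _ _)) perm_cat2l.
by rewrite perm_sym; case: p eqE.
Qed.

Lemma good_front n e f E : can_front e f E -> good n E -> good n (front e f E).
Proof.
by case/and3P=> eE fE _ gE; apply: (good_pick (F := [:: e])) => //; apply: (good_pick (F := [::])).
Qed.

(** With the repeated terminals, [plug] subdivides the two edges by [n] and [n + 1]; [rung] joins
    these vertices. *)
Definition rung_terminals : nat * nat * nat * nat := (0, 0, 1, 1).
Definition rung : seq edge := [:: (0, 1)].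

Lemma rung_gadget : gadget 2 rung_terminals rung.
Proof. by vm_compute. Qed.

Definition add_rung (n : nat) (E : seq edge) (ef : edge * edge) : seq edge :=
  plug n rung_terminals rung (front ef.1 ef.2 E).

Fixpoint add_rungs (n : nat) (E : seq edge) (s : seq (edge * edge)) : seq edge :=
  if s is ef :: s' then add_rungs n.+2 (add_rung n E ef) s' else E.

Fixpoint can_add_rungs (n : nat) (E : seq edge) (s : seq (edge * edge)) : bool :=
  if s is ef :: s' then can_front ef.1 ef.2 E && can_add_rungs n.+2 (add_rung n E ef) s'
  else true.

Lemma good_add_rungs n E s : 3 < n -> good n E -> can_add_rungs n E s ->
  good (n + (size s).*2) (add_rungs n E s).
Proof.
elim: s n E => [|[[a b] [c d]] s IH] n E gt3n gE /=; first by rewrite addn0.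
case/andP=> cf cs; rewrite doubleS !addnS -!addSn; apply: IH cs; first by rewrite ltnW // ltnW.
rewrite -addn2; case/and3P: (cf) => _ _ uniq_abcd.
exact: plug_good rung_gadget (good_front cf gE) uniq_abcd gt3n.
Qed.

Definition K4 : seq edge := [:: (0, 1); (0, 2); (0, 3); (1, 2); (1, 3); (2, 3)].

(** The sets to be considered for connectivity are the pairs of vertices, and each pair has a cut of
    four edges. *)
Lemma good_K4 : good 4 K4.
Proof.
split=> //; first by case=> [|[|[|[|]]]].
move=> X; rewrite /= !addn0 /cut /K4 /=.
by case: (X 0); case: (X 1); case: (X 2); case: (X 3).
Qed.
(* Found by computer search: seven copies of [p8] joined with [4 + 2 r] further vertices
   ([r <= 3]). [core_moves] builds these graphs from [K4]. The list [core_vars] gives the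
   positions in [halves] of the edges that the search colours, in this order. A step
   [(i, vs, s)] colours the dangling edges [i :: vs] of a vertex (with [s] empty) or of a copy
   of [p8] whose inner edges are at the positions [s]. The four halves of [core_e] and
   [core_f] come at the places [core_ends] of the order. *)
Definition core_moves : seq (edge * edge) :=
  [:: ((3, 0), (2, 1)); ((4, 5), (3, 2)); ((5, 1), (2, 0));
      ((1, 8), (0, 9)); ((10, 8), (5, 6)); ((4, 6), (7, 2));
      ((6, 14), (1, 3)); ((11, 9), (16, 14)); ((3, 7), (4, 14));
      ((4, 0), (3, 17)); ((18, 19), (14, 15)); ((15, 2), (6, 7));
      ((25, 15), (21, 14)); ((14, 29), (28, 15)); ((27, 7), (15, 31));
      ((8, 12), (2, 26)); ((12, 34), (13, 6)); ((8, 5), (35, 26));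
      ((37, 6), (12, 10)); ((0, 11), (10, 41)); ((18, 9), (24, 25));
      ((24, 19), (18, 11)); ((32, 7), (26, 39)); ((14, 19), (28, 29));
      ((20, 21), (22, 23)); ((46, 47), (44, 45)); ((42, 43), (1, 17));
      ((12, 13), (40, 6)); ((6, 16), (34, 36)); ((6, 59), (36, 61));
      ((16, 60), (36, 63))].

Definition core_e : edge := (5, 13).
Definition core_f : edge := (43, 41).

Definition core_vars0 : seq nat :=
  [:: 10; 75; 83; 35; 74; 2; 68; 78; 82; 81; 34; 24; 39; 59; 38; 30; 70; 5; 52; 0; 3; 1].
Definition core_steps0 : seq (nat * seq nat * seq nat) :=
  [:: (0, [:: 1; 2], [::]);
      (0, [:: 3; 4; 5], [:: 85; 44; 86; 11; 9; 13; 43; 91; 42; 12]);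
      (1, [:: 6; 4; 7], [:: 23; 21; 19; 89; 79; 77; 76; 22; 80; 20]);
      (2, [:: 8; 9], [::]);
      (9, [:: 10; 11], [::]);
      (6, [:: 12; 11; 13], [:: 27; 65; 67; 64; 66; 63; 26; 28; 73; 25]);
      (3, [:: 12; 14; 10], [:: 72; 36; 41; 18; 16; 14; 17; 40; 15; 37]);
      (13, [:: 15; 7; 16], [:: 69; 71; 32; 31; 60; 62; 29; 84; 33; 61]);
      (8, [:: 16; 17], [::]);
      (14, [:: 15; 18; 19], [:: 49; 48; 51; 57; 90; 87; 58; 56; 50; 88]);
      (18, [:: 17; 20; 21], [:: 6; 4; 8; 45; 54; 55; 47; 46; 7; 53])].
Definition core_ends0 : seq nat := [:: 19; 21; 5; 20].

Definition core_vars1 : seq nat :=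
  [:: 15; 79; 86; 40; 78; 2; 72; 82; 4; 85; 39; 29; 44; 63; 43; 35; 74; 7; 0; 5; 8; 6; 10; 3; 1].
Definition core_steps1 : seq (nat * seq nat * seq nat) :=
  [:: (0, [:: 1; 2], [::]);
      (0, [:: 3; 4; 5], [:: 88; 49; 89; 16; 14; 18; 48; 94; 47; 17]);
      (1, [:: 6; 4; 7], [:: 28; 26; 24; 92; 83; 81; 80; 27; 84; 25]);
      (2, [:: 8; 9], [::]);
      (9, [:: 10; 11], [::]);
      (6, [:: 12; 11; 13], [:: 32; 69; 71; 68; 70; 67; 31; 33; 77; 30]);
      (3, [:: 12; 14; 10], [:: 76; 41; 46; 23; 21; 19; 22; 45; 20; 42]);
      (13, [:: 15; 7; 16], [:: 73; 75; 37; 36; 64; 66; 34; 87; 38; 65]);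
      (14, [:: 15; 17; 18], [:: 54; 53; 56; 61; 93; 90; 62; 60; 55; 91]);
      (17, [:: 19; 20], [::]);
      (8, [:: 20; 21], [::]);
      (21, [:: 16; 22], [::]);
      (19, [:: 22; 23; 24], [:: 11; 9; 13; 50; 58; 59; 52; 51; 12; 57])].
Definition core_ends1 : seq nat := [:: 18; 24; 5; 23].

Definition core_vars2 : seq nat :=
  [:: 18; 82; 89; 75; 81; 85; 43; 2; 9; 88; 42; 32; 47; 66; 46; 38; 77; 11; 0; 5; 12; 10; 6; 4; 8;
    7; 3; 1].
Definition core_steps2 : seq (nat * seq nat * seq nat) :=
  [:: (0, [:: 1; 2], [::]);
      (1, [:: 3; 4; 5], [:: 31; 29; 27; 95; 86; 84; 83; 30; 87; 28]);
      (0, [:: 6; 4; 7], [:: 91; 52; 92; 19; 17; 21; 51; 97; 50; 20]);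
      (2, [:: 8; 9], [::]);
      (9, [:: 10; 11], [::]);
      (3, [:: 12; 11; 13], [:: 35; 72; 74; 71; 73; 70; 34; 36; 80; 33]);
      (6, [:: 12; 14; 10], [:: 79; 44; 49; 26; 24; 22; 25; 48; 23; 45]);
      (13, [:: 15; 5; 16], [:: 76; 78; 40; 39; 67; 69; 37; 90; 41; 68]);
      (14, [:: 15; 17; 18], [:: 57; 56; 59; 64; 96; 93; 65; 63; 58; 94]);
      (17, [:: 19; 20], [::]);
      (8, [:: 20; 21], [::]);
      (21, [:: 16; 22], [::]);
      (22, [:: 23; 24], [::]);
      (19, [:: 24; 25], [::]);
      (25, [:: 23; 26; 27], [:: 14; 13; 16; 53; 61; 62; 55; 54; 15; 60])].
Definition core_ends2 : seq nat := [:: 18; 27; 7; 26].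

Definition core_vars3 : seq nat :=
  [:: 21; 85; 92; 46; 84; 2; 78; 88; 6; 91; 45; 35; 50; 49; 69; 41; 80; 14; 0; 11; 13; 10; 15; 4;
    8; 9; 12; 5; 7; 3; 1].
Definition core_steps3 : seq (nat * seq nat * seq nat) :=
  [:: (0, [:: 1; 2], [::]);
      (0, [:: 3; 4; 5], [:: 94; 55; 95; 22; 20; 24; 54; 100; 53; 23]);
      (1, [:: 6; 4; 7], [:: 34; 32; 30; 98; 89; 87; 86; 33; 90; 31]);
      (2, [:: 8; 9], [::]);
      (9, [:: 10; 11], [::]);
      (3, [:: 12; 13; 10], [:: 82; 47; 52; 29; 27; 25; 28; 51; 26; 48]);
      (12, [:: 6; 11; 14], [:: 74; 76; 73; 38; 75; 77; 39; 37; 36; 83]);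
      (14, [:: 15; 7; 16], [:: 79; 81; 43; 42; 70; 72; 40; 93; 44; 71]);
      (13, [:: 15; 17; 18], [:: 60; 59; 62; 67; 99; 96; 68; 66; 61; 97]);
      (16, [:: 19; 20], [::]);
      (17, [:: 21; 22], [::]);
      (20, [:: 22; 23], [::]);
      (8, [:: 23; 24], [::]);
      (19, [:: 25; 26], [::]);
      (21, [:: 26; 27], [::]);
      (27, [:: 24; 28], [::]);
      (28, [:: 25; 29; 30], [:: 17; 16; 19; 56; 64; 65; 58; 57; 18; 63])].
Definition core_ends3 : seq nat := [:: 18; 30; 5; 29].

(** Each rung adds two vertices, so 28 of them lead from the 4 vertices of [K4] to 60. *)
Definition core (r : nat) : seq edge :=
  front core_e core_f (add_rungs 4 K4 (take (28 + r) core_moves)).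

Lemma core_good r : r <= 3 -> good (60 + r.*2) (core r) /\ uniq [:: core_e.1; core_e.2; core_f.1;
  core_f.2].
Proof.
move=> le_r3; split=> //.
have [can_r can_f] : can_add_rungs 4 K4 (take (28 + r) core_moves) /\
    can_front core_e core_f (add_rungs 4 K4 (take (28 + r) core_moves)).
  by case: r le_r3 => [|[|[|[|]]]] // _; vm_compute.
have -> : 60 + r.*2 = 4 + (size (take (28 + r) core_moves)).*2.
  by case: r le_r3 {can_r can_f} => [|[|[|[|]]]].
apply: good_front can_f _; exact: (@good_add_rungs 4 K4 _ isT good_K4 can_r).
Qed.

Lemma core_tight0 : tight_cert (core 0) core_vars0 core_steps0 core_ends0.
Proof. by vm_compute. Qed.

Lemma core_tight1 : tight_cert (core 1) core_vars1 core_steps1 core_ends1.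
Proof. by vm_compute. Qed.

Lemma core_tight2 : tight_cert (core 2) core_vars2 core_steps2 core_ends2.
Proof. by vm_compute. Qed.

Lemma core_tight3 : tight_cert (core 3) core_vars3 core_steps3 core_ends3.
Proof. by vm_compute. Qed.

Lemma core_tight r : r <= 3 -> tight (core r).
Proof.
case: r => [|[|[|[|]]]] // _; apply: tight_certP.
- exact: core_tight0.
- exact: core_tight1.
- exact: core_tight2.
- exact: core_tight3.
Qed.

Lemma core_simple_girth r : r <= 3 -> simple (core r) && girth_ge5b (60 + r.*2) (core r).
Proof. by case: r => [|[|[|[|]]]] // _; vm_compute. Qed.

Lemma core_pentagon r : r <= 3 -> pentagon (core r) [:: 0; 1; 10; 11; 42].
Proof. by case: r => [|[|[|[|]]]] // _; vm_compute. Qed.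

Lemma core_witness r : r <= 3 -> witness (60 + r.*2) (core r).
Proof.
move=> le_r3; have [good_r uniq_ef] := core_good le_r3.
have [bound_r loop_r _ _] := good_r; have /andP[simple_r girth_r] := core_simple_girth le_r3.
split; last by exists core_e, core_f; eexists; split=> //; apply: core_tight.
split=> //; first exact: girth_ge5P girth_r.
by exists [:: 0; 1; 10; 11; 42]; apply: core_pentagon.
Qed.

Theorem theorem7 (n : nat) (n_ge60 : 60 <= n) (n_even : ~~ odd n) :
  exists G : sgraph,
    [/\ #|G| = n,
        cubic G,
        cyclically_edge_connected G 4,
        has_girth G 5
      & ~ exists phi : {set G} -> {set petersen}, P_coloring phi].
Proof.
have [r [k [le_r3 def_n]]] : exists r k, r <= 3 /\ n = 60 + r.*2 + 8 * k.
  (* The remainder selects one of the four small graphs, the quotient is the number of inserted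
     copies of [p8]. *)
  by exists ((n - 60)./2 %% 4), ((n - 60)./2 %/ 4); split; lia.
have [E wE] := witness_iter k (core_witness le_r3); rewrite -def_n in wE.
exists (list_graph n E); split.
- exact: list_graph_card.
- exact: list_graph_cubic.
- exact: list_graph_connected.
- exact: list_graph_girth.
- exact: list_graph_uncolourable.
Qed.
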